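(* Let $G$ be a finite group. Then \[ \frac{M_{2}(\mathcal{B}(G))}{|e(\mathcal{B}(G))|} \geq \frac{M_{1}(\mathcal{B}(G))}{|V(\mathcal{B}(G))|} \] if and only if $|L(G)|\,P-1 \geq 0$, where $P=\sum_{H \in L(G)}(\Pr_H(G))^2$.
   Context: For a finite group $G$, $L(G)$ denotes the set of all subgroups of $G$. The subgroup generating bipartite graph $\mathcal{B}(G)$ is the simple undirected bipartite graph whose vertex set is the disjoint union $(G\times G)\sqcup L(G)$, where $(a,b)\in G\times G$ and $H\in L(G)$ are adjacent if and only if $H=\langle a,b\rangle$ (the subgroup generated by $a$ and $b$); there are no other edges. For a subgroup $H$ of $G$, $\Pr_H(G)$ is the probability that a uniformly random pair $(a,b)\in G\times G$ generates $H$, i.e. $\Pr_H(G)=|\{(a,b)\in G\times G:\langle a,b\rangle=H\}|/|G|^2$. For a finite simple graph $\mathcal{G}$ with vertex set $V(\mathcal{G})$ and edge set $e(\mathcal{G})$, the first and second Zagreb indices are $M_1(\mathcal{G})=\sum_{v\in V(\mathcal{G})}\deg(v)^2$ and $M_2(\mathcal{G})=\sum_{uv\in e(\mathcal{G})}\deg(u)\deg(v)$. *)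

(* Defs.v *)
From HB Require Import structures.
From mathcomp Require Import all_boot all_order all_algebra all_fingroup.

Set Implicit Arguments.
Unset Strict Implicit.
Unset Printing Implicit Defensive.

Import Order.TTheory GRing.Theory Num.Theory.

Local Open Scope nat_scope.

Record sgraph := SGraph {
  vertex :> finType;
  adj : rel vertex;
  adj_sym : symmetric adj;
  adj_irrefl : irreflexive adj
}.

Section GraphInvariants.
Variable X : sgraph.

Definition deg (v : X) : nat := #|[set w : X | adj v w]|.

(* An edge is the unordered pair of its end vertices. *)
Definition edges : {set {set X}} :=
  [set [set uv.1; uv.2] | uv : X * X & adj uv.1 uv.2].

Definition zagreb1 : nat := \sum_(v : X) deg v ^ 2.

(* An edge has exactly two elements, since adj is irreflexive, so the inner
   product is deg u * deg v for the edge uv. *)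
Definition zagreb2 : nat := \sum_(e in edges) \prod_(v in e) deg v.

End GraphInvariants.

Section SubgroupGeneratingGraph.
Variables (gT : finGroupType) (G : {group gT}).

Definition sgb_vertex : finType :=
  ({ab : gT * gT | ab \in setX G G} + {H : {group gT} | H \in subgroups G})%type.

Definition sgb_adj (u v : sgb_vertex) : bool :=
  match u, v with
  | inl ab, inr H | inr H, inl ab =>
      val H :==: <<[set (val ab).1; (val ab).2]>>%g
  | _, _ => false
  end.

Lemma sgb_adj_sym : symmetric sgb_adj.
Proof. by case=> [ab|H] [cd|K]. Qed.

Lemma sgb_adj_irrefl : irreflexive sgb_adj.
Proof. by case. Qed.

Definition sgb_graph : sgraph := SGraph sgb_adj_sym sgb_adj_irrefl.

Definition gen_prob (H : {group gT}) : rat :=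
  (#|[set ab in setX G G | <<[set ab.1; ab.2]>>%g == H :> {set gT}]|%:R
     / (#|G| ^ 2)%:R)%R.

End SubgroupGeneratingGraph.

(* Main.v *)
Require Import Defs.
From HB Require Import structures.
From mathcomp Require Import all_boot all_order all_algebra all_fingroup.

(** Every pair (a, b) is joined to exactly one subgroup, namely <<a, b>>, so the
    graph is a disjoint union of stars centred at the subgroups of G.  Write
    d_H for the number of pairs generating H; this is the degree of H, and every
    pair has degree 1.  With n = |G|^2, l = |L(G)| and S the sum of the d_H ^ 2,
    - the edges biject with the pairs, so |e| = n, while |V| = n + l
      ([card_edges_sgb], [card_sgb_graph]);
    - M_1 = n + S ([zagreb1_sgb]);
    - the edge through a pair generating H contributes 1 * d_H to M_2, and H
      lies on d_H edges, so M_2 = S as well ([zagreb2_sgb]);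
    - P = S / n ^ 2 ([sum_gen_prob_sq]).
    The Zagreb inequality S / n >= (n + S) / (n + l) clears denominators to
    S l >= n ^ 2 ([star_ratio_le]), which is l P >= 1. *)

Set Implicit Arguments.
Unset Strict Implicit.
Unset Printing Implicit Defensive.

Import Order.TTheory GRing.Theory Num.Theory.
Local Open Scope ring_scope.

Section StarStructure.
Variables (gT : finGroupType) (G : {group gT}).
Local Open Scope nat_scope.

Local Notation pairs := {ab : gT * gT | ab \in setX G G}.
Local Notation subgrps := {H : {group gT} | H \in subgroups G}.

Definition npairs (H : {group gT}) : nat :=
  #|[set ab in setX G G | <<[set ab.1; ab.2]>>%g == H :> {set gT}]|.

Lemma gen_pair_subproof (p : pairs) :
  <<[set (val p).1; (val p).2]>>%G \in subgroups G.
Proof.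
case: p => [[a b] /=]; rewrite inE => /andP[aG bG].
by rewrite inE gen_subG subUset !sub1set; apply/andP.
Qed.

(** The centre of the star to which p belongs, as an element of the vertex
    summand of subgroups. *)
Definition gen_pair (p : pairs) : subgrps :=
  exist (fun H : {group gT} => H \in subgroups G) _ (gen_pair_subproof p).

Lemma sgb_adj_pair (p : pairs) (H : subgrps) :
  sgb_adj (inl p) (inr H) = (gen_pair p == H).
Proof. by rewrite /= eq_sym -val_eqE. Qed.

Lemma card_pairs : #|{: pairs}| = #|G| ^ 2.
Proof. by rewrite card_sig -mulnn -cardsX; apply: eq_card => x; rewrite !inE. Qed.

Lemma card_subgrps : #|{: subgrps}| = #|subgroups G|.
Proof. by rewrite card_sig; apply: eq_card => x; rewrite !inE. Qed.

Lemma card_sgb_graph : #|sgb_graph G| = #|G| ^ 2 + #|subgroups G|.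
Proof. by rewrite -card_pairs -card_subgrps -card_sum. Qed.

(** Transports the count from G x G, where the probability is defined, to the
    subtype of vertices, where degrees are. *)
Lemma npairs_gen_pair (H : subgrps) :
  npairs (val H) = #|[set p : pairs | gen_pair p == H]|.
Proof.
rewrite -(card_imset [set p : pairs | gen_pair p == H] val_inj).
apply: eq_card => ab; rewrite inE; apply/andP/imsetP => [[abG gH]|[p]].
  by exists (exist (fun ab => ab \in setX G G) ab abG); rewrite // inE -val_eqE.
by rewrite inE -val_eqE => gH ->; split; first exact: (valP p).
Qed.

Lemma deg_pair (p : pairs) : deg (inl p : sgb_graph G) = 1.
Proof.
apply/eqP/cards1P; exists (inr (gen_pair p)); apply/setP => -[q|H].
  by rewrite !inE.
rewrite !inE [LHS]sgb_adj_pair eq_sym.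
by apply/eqP/eqP => [->|[->]].
Qed.

Lemma deg_subgroup (H : subgrps) :
  deg (inr H : sgb_graph G) = npairs (val H).
Proof.
have inl_inj : injective (inl : pairs -> sgb_graph G) by move=> p q [].
rewrite npairs_gen_pair -(card_imset _ inl_inj).
apply: eq_card => -[p|K]; last first.
  by rewrite inE; apply/esym/imsetP => -[].
by rewrite (mem_imset _ _ inl_inj) !inE -sgb_adj_pair.
Qed.

Definition star_edge (p : pairs) : {set sgb_graph G} :=
  [set inl p; inr (gen_pair p)].

Lemma star_edge_inj : injective star_edge.
Proof.
by move=> p q /setP /(_ (inl p)); rewrite !inE eqxx /= orbF => /esym/eqP[].
Qed.

(** An edge never joins two pairs or two subgroups, and its pair determines its
    subgroup; so edges can be indexed by pairs, which turns every sum over edges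
    into a sum over pairs. *)
Lemma edges_sgbE : edges (sgb_graph G) = [set star_edge p | p in {: pairs}].
Proof.
apply/setP => e; apply/imsetP/imsetP => [[[[p|H] [q|K]]]|[p _ ->]].
- by rewrite inE.
- rewrite inE => pK ->; exists p => //.
  by have /eqP <- : gen_pair p == K by rewrite -sgb_adj_pair.
- rewrite inE adj_sym => qH ->; exists q => //.
  have /eqP <- : gen_pair q == H by rewrite -sgb_adj_pair.
  by rewrite [LHS]setUC.
- by rewrite inE.
exists (inl p, inr (gen_pair p)) => //.
by rewrite inE; apply: eqxx.
Qed.

Lemma card_edges_sgb : #|edges (sgb_graph G)| = #|G| ^ 2.
Proof. by rewrite edges_sgbE (card_imset _ star_edge_inj) card_pairs. Qed.

Lemma zagreb1_sgb :
  zagreb1 (sgb_graph G) = #|G| ^ 2 + \sum_(H in subgroups G) npairs H ^ 2.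
Proof.
rewrite /zagreb1 [LHS]big_sumType; congr (_ + _).
  under eq_bigr do rewrite deg_pair.
  by rewrite sum1_card card_pairs.
by rewrite [RHS]big_sub; apply: eq_bigr => H _; rewrite deg_subgroup.
Qed.

Lemma prod_deg_star_edge (p : pairs) :
  \prod_(v in star_edge p) deg v = npairs (val (gen_pair p)).
Proof.
by rewrite big_setU1 ?inE // big_set1 deg_pair [LHS]mul1n deg_subgroup.
Qed.

(** A subgroup generated by d pairs is the centre of d edges of weight d. *)
Lemma zagreb2_sgb :
  zagreb2 (sgb_graph G) = \sum_(H in subgroups G) npairs H ^ 2.
Proof.
rewrite /zagreb2 edges_sgbE big_imset /=; last exact: in2W star_edge_inj.
under eq_bigr do rewrite prod_deg_star_edge.
(* Group the pairs by the subgroup they generate. *)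
rewrite (partition_big gen_pair predT) // [RHS]big_sub; apply: eq_bigr => H _.
rewrite (eq_bigr (fun=> npairs (val H))) => [|p /eqP -> //].
rewrite sum_nat_const -mulnn; congr (_ * _).
by rewrite npairs_gen_pair; apply: eq_card => p; rewrite inE.
Qed.

Lemma sum_gen_prob_sq :
  (\sum_(H in subgroups G) gen_prob G H ^+ 2 =
    (\sum_(H in subgroups G) npairs H ^ 2)%:R / ((#|G| ^ 2)%:R ^+ 2) :> rat)%R.
Proof.
rewrite natr_sum mulr_suml; apply: eq_bigr => H _.
by rewrite (natrX _ (npairs H)) -expr_div_n.
Qed.

End StarStructure.

(** Cross-multiplying gives n * (n + s) <= s * (n + l), in which n * s occurs on
    both sides; what is left is n ^ 2 <= l * s. *)
Lemma star_ratio_le (F : realFieldType) (n l s : F) : 0 < n -> 0 <= l ->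
  ((n + s) / (n + l) <= s / n) = (0 <= l * (s / n ^+ 2) - 1).
Proof.
move=> n_gt0 l_ge0; have nl_gt0 : 0 < n + l by apply: ltr_wpDr.
rewrite subr_ge0 mulrA !ler_pdivlMr ?exprn_gt0 // mul1r.
rewrite mulrAC ler_pdivrMr // mulrDl mulrDr -expr2 (mulrC l s).
by rewrite addrC lerD2l.
Qed.

Theorem theorem3p3 (gT : finGroupType) (G : {group gT}) :
  ((zagreb2 (sgb_graph G))%:R / #|edges (sgb_graph G)|%:R : rat)
    >= (zagreb1 (sgb_graph G))%:R / #|sgb_graph G|%:R
  <->
  #|subgroups G|%:R * (\sum_(H in subgroups G) gen_prob G H ^+ 2) - 1 >= 0.
Proof.
rewrite zagreb1_sgb zagreb2_sgb card_edges_sgb card_sgb_graph sum_gen_prob_sq.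
by rewrite !natrD star_ratio_le // ltr0n expn_gt0 cardG_gt0.
Qed.
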